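(* Let $X$ and $Y$ be closed infinite-codimensional subspaces of a Banach space $E$ such that $X+Y$ is dense in $E$. If $X$ has a separable quotient and $X+Y$ is not closed, then there exists a closed subspace $X_1\subset X$ such that $\dim(X/X_1)=\infty$ and $X_1+Y$ is dense in $E$.
   Context: All spaces are real. A Banach space $X$ has a separable quotient if there is a closed subspace $N\subset X$ such that $X/N$ is infinite-dimensional and separable. *)

(* Defs.v *)
From HB Require Import structures.
From mathcomp Require Import all_boot all_order all_algebra.
From mathcomp Require Import all_classical all_reals all_analysis.
Set Implicit Arguments.
Unset Strict Implicit.
Unset Printing Implicit Defensive.
Import Order.TTheory GRing.Theory Num.Theory.
Import numFieldNormedType.Exports.
Local Open Scope classical_set_scope.
Local Open Scope ring_scope.
Local Open Scope quotient_scope.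

Definition finite_dimensional (R : realType) (V : lmodType R) : Prop :=
  exists (n : nat) (v : 'I_n -> V),
    forall x : V, exists c : 'I_n -> R, x = \sum_(i < n) c i *: v i.

Definition infinite_dimensional (R : realType) (V : lmodType R) : Prop :=
  ~ finite_dimensional V.

Definition separable (T : topologicalType) : Prop :=
  exists D : set T, countable D /\ dense D.

Record closedSubspace (R : realType) (E : normedModType R) := ClosedSubspace {
  closed_subspace_pred :> {pred E};
  closed_subspaceP : submod_closed closed_subspace_pred;
  closed_subspaceC : closed [set` closed_subspace_pred]
}.

HB.instance Definition _ (R : realType) (E : normedModType R)
    (X : closedSubspace E) :=
  GRing.isSubmodClosed.Build R E (closed_subspace_pred X) (closed_subspaceP X).

Record subspaceType (R : realType) (E : normedModType R)
    (X : closedSubspace E) := SubspaceType {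
  subspace_val : E;
  subspace_valP : subspace_val \in X
}.

Section SubspaceType.
Context (R : realType) (E : normedModType R) (X : closedSubspace E).
Local Notation T := (subspaceType X).

HB.instance Definition _ := [isSub for @subspace_val R E X].
HB.instance Definition _ := [Choice of T by <:].
HB.instance Definition _ := [SubChoice_isSubLmodule of T by <:].

Let norm (x : T) : R := `|\val x|.

Let norm_triangle (x y : T) : norm (x + y) <= norm x + norm y.
Proof. by rewrite /norm raddfD ler_normD. Qed.

Let norm_scale (a : R) (x : T) : norm (a *: x) = `|a| * norm x.
Proof. by rewrite /norm linearZ normrZ. Qed.

Let norm_eq0 (x : T) : norm x = 0 -> x = 0.
Proof. by move=> /normr0_eq0 x0; apply: val_inj; rewrite x0 raddf0. Qed.

HB.instance Definition _ :=
  Lmodule_isNormed.Build R T norm_triangle norm_scale norm_eq0.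

End SubspaceType.

(* The intersection of X and N as a closed subspace of the normed space X; when
   N is contained in X, [quotientType (trace X N)] is the quotient X/N. *)
Section Trace.
Context (R : realType) (E : normedModType R) (X N : closedSubspace E).

Definition trace_pred : {pred subspaceType X} := [pred x | \val x \in N].

Lemma trace_submod_closed : submod_closed trace_pred.
Proof.
split=> [|a u v]; first by rewrite !inE raddf0 rpred0.
by rewrite !inE => Nu Nv; rewrite linearP rpredD ?rpredZ.
Qed.

Lemma subspace_val_continuous :
  continuous (\val : subspaceType X -> E).
Proof.
move=> x; apply/(@cvgrPdist_lt _ _ _ (nbhs x)) => e e0.
apply: filterS (nbhsx_ballx x e e0) => y.
by rewrite -ball_normE.
Qed.

Lemma trace_closed : closed [set` trace_pred].
Proof.
have := closed_subspaceC (c := N).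
by move/(closed_comp (fun x _ => @subspace_val_continuous x)).
Qed.

Definition trace : closedSubspace (subspaceType X) :=
  ClosedSubspace trace_submod_closed trace_closed.

End Trace.

Definition quotientType (R : realType) (E : normedModType R)
  (N : closedSubspace E) := Quotient.quot N.

Section Quotient.
Context (R : realType) (E : normedModType R) (N : closedSubspace E).
Local Notation Q := (quotientType N).

HB.instance Definition _ := GRing.Zmodule.on Q.
HB.instance Definition _ := Quotient.on Q.

Lemma quotient_eqP (x y : E) : reflect (\pi_Q x = \pi_Q y) (x - y \in N).
Proof. by rewrite (Quotient.idealrBE N); apply: eqP. Qed.

Lemma quotient_piD (x y : E) : \pi_Q (x + y) = \pi_Q x + \pi_Q y.
Proof. exact: Quotient.pi_add. Qed.

Lemma quotient_pi0 : \pi_Q 0 = 0.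
Proof. by apply: (addIr (\pi_Q 0)); rewrite -quotient_piD addr0 add0r. Qed.

Definition quotient_scale (a : R) (u : Q) : Q := \pi_Q (a *: repr u).

Lemma quotient_scale_pi a x : quotient_scale a (\pi_Q x) = \pi_Q (a *: x).
Proof.
apply/quotient_eqP; rewrite -scalerBr rpredZ//.
by apply/quotient_eqP; rewrite reprK.
Qed.

Let scaleA a b u :
  quotient_scale a (quotient_scale b u) = quotient_scale (a * b) u.
Proof.
elim/quotW: u => x.
by rewrite [quotient_scale b _]quotient_scale_pi !quotient_scale_pi scalerA.
Qed.

Let scale1 : left_id 1 quotient_scale.
Proof. by elim/quotW => x; rewrite quotient_scale_pi scale1r. Qed.

Let scaleDr : right_distributive quotient_scale +%R.
Proof.
move=> a; elim/quotW => x; elim/quotW => y.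
by rewrite -quotient_piD !quotient_scale_pi scalerDr quotient_piD.
Qed.

Let scaleDl u : {morph quotient_scale^~ u : a b / a + b}.
Proof.
move=> a b; elim/quotW: u => x.
by rewrite !quotient_scale_pi scalerDl quotient_piD.
Qed.

HB.instance Definition _ :=
  GRing.Zmodule_isLmodule.Build R Q scaleA scale1 scaleDr scaleDl.

Lemma quotient_piZ a (x : E) : \pi_Q (a *: x) = a *: \pi_Q x.
Proof. by rewrite -quotient_scale_pi. Qed.

Definition quotient_norm (u : Q) : R :=
  inf [set `|x| | x in [set x : E | \pi_Q x = u]].

Let norm_lbound (u : Q) :
  lbound [set `|x| | x in [set x : E | \pi_Q x = u]] 0.
Proof. by move=> _ [x _ <-]. Qed.

Lemma quotient_norm_le (u : Q) (x : E) : \pi_Q x = u -> quotient_norm u <= `|x|.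
Proof.
by move=> xu; apply: ge_inf; [exists 0; exact: norm_lbound | exists x].
Qed.

Lemma quotient_norm_adherent (u : Q) (e : R) : 0 < e ->
  exists2 x : E, \pi_Q x = u & `|x| < quotient_norm u + e.
Proof.
move=> e0; have [|_ [x xu <-] xe] := inf_adherent e0 (E :=
  [set `|x| | x in [set x : E | \pi_Q x = u]]); last by exists x.
by split; [exists `|repr u|, (repr u); rewrite //= reprK
          | exists 0; exact: norm_lbound].
Qed.

Let norm_triangle (u v : Q) :
  quotient_norm (u + v) <= quotient_norm u + quotient_norm v.
Proof.
apply/ler_addgt0Pr => e e0; have e20 : 0 < e / 2 by rewrite divr_gt0.
have [x xu xe] := quotient_norm_adherent u e20.
have [y yv ye] := quotient_norm_adherent v e20.
have /quotient_norm_le/le_trans -> // : \pi_Q (x + y) = u + v.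
  by rewrite quotient_piD xu yv.
rewrite (le_trans (ler_normD _ _))// (splitr e) addrACA ltW// ltrD//.
Qed.

Let norm_scale_le (a : R) (u : Q) :
  quotient_norm (a *: u) <= `|a| * quotient_norm u.
Proof.
apply/ler_addgt0Pr => e e0.
have d0 : 0 < e / (`|a| + 1) by rewrite divr_gt0// ltr_wpDl.
have [x xu xe] := quotient_norm_adherent u d0.
have /quotient_norm_le/le_trans -> // : \pi_Q (a *: x) = a *: u.
  by rewrite quotient_piZ xu.
rewrite normrZ (le_trans (ler_wpM2l _ (ltW xe)))// mulrDr lerD2l.
by rewrite mulrCA ler_piMr ?(ltW e0)// ler_pdivrMr ?mul1r ?lerDl// ltr_wpDl.
Qed.

Let norm_scale (a : R) (u : Q) :
  quotient_norm (a *: u) = `|a| * quotient_norm u.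
Proof.
apply/le_anti; rewrite norm_scale_le/=.
have [->|a0] := eqVneq a 0.
  rewrite normr0 mul0r; apply: lb_le_inf; last exact: norm_lbound.
  by exists `|repr (0 *: u)|, (repr (0 *: u)); rewrite //= reprK.
rewrite -ler_pdivlMl ?normr_gt0//.
have := norm_scale_le a^-1 (a *: u).
by rewrite scalerA mulVf// scale1r normfV.
Qed.

Let norm_eq0 (u : Q) : quotient_norm u = 0 -> u = 0.
Proof.
move=> u0; rewrite -[u]reprK -quotient_pi0; apply/quotient_eqP; rewrite subr0.
suff : [set` closed_subspace_pred N] (repr u) by [].
apply: (closed_subspaceC (c := N)) => B /nbhs_ballP[e /= e0 eB].
have [x xu xe] := quotient_norm_adherent u e0.
exists (repr u - x); split.
  by apply/quotient_eqP; rewrite xu reprK.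
apply: eB; rewrite -ball_normE /ball_ /= opprB addrC subrK.
by rewrite u0 add0r in xe.
Qed.

HB.instance Definition _ :=
  Lmodule_isNormed.Build R Q norm_triangle norm_scale norm_eq0.

End Quotient.

Definition infinite_codimensional (R : realType) (E : normedModType R)
    (X : closedSubspace E) : Prop :=
  infinite_dimensional (quotientType X).

Definition has_separable_quotient (R : realType) (E : normedModType R) : Prop :=
  exists N : closedSubspace E,
    infinite_dimensional (quotientType N) /\ separable (quotientType N).

Definition sum_subspace (R : realType) (E : normedModType R)
    (X Y : closedSubspace E) : set E :=
  [set x + y | x in [set` X] & y in [set` Y]].

(* Main.v *)
(* Let N be a closed subspace of X with X/N infinite-dimensional and separable.
   Since X + Y is not closed, no finite-codimensional subspace of X stays at a
   positive distance from Y on its unit sphere.  Choose recursively unit vectors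
   u_k in X very close to Y, norm one functionals f_k with f_k(u_k) = 1 and
   f_j(u_k) = 0 for j < k, and linearly independent functionals g_k on X that
   vanish on N and on every u_j.  Then N' = X cap ker g_0 cap ker g_1 cap ...
   contains N and all u_k and has infinite codimension in X.

   Let (w_m) be a sequence in X that is dense modulo N, let b_k be a positive
   multiple, of norm at most one, of w_s(k), where s takes each value infinitely
   often, and put A = sum_k eta_k f_k(.) b_k with eta_k decreasing so fast that
   |A| <= 1/2 and A u_k = eta_k b_k + o(eta_k).  The space X1 = (I + A) N' is
   closed, and has infinite codimension in X because I + A is an automorphism of
   X.  As u_k + A u_k is in X1 and u_k is within o(eta_k) of Y, the closure of
   X1 + Y contains every w_m, hence the range of A, hence N' and X. *)

From HB Require Import structures.
Require Import Defs.
From mathcomp Require Import all_boot all_order all_algebra.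
From mathcomp Require Import all_classical all_reals all_analysis.
From mathcomp Require Import ring lra zify.
Local Open Scope classical_set_scope.
Local Open Scope ring_scope.
Set Implicit Arguments.
Unset Strict Implicit.
Unset Printing Implicit Defensive.
Import Order.TTheory GRing.Theory Num.Theory.
Import numFieldNormedType.Exports.
Local Open Scope quotient_scope.

(** * The Hahn-Banach theorem for norms *)

Section HahnBanach.
Context (R : realType) (V : normedModType R) (b : V).
Hypothesis b_neq0 : b != 0.

Let p (x : V) : R := `|x| / `|b|.

Let pD x y : p (x + y) <= p x + p y.
Proof. by rewrite -mulrDl ler_wpM2r ?invr_ge0// ler_normD. Qed.

Let pZ t x : p (t *: x) = `|t| * p x.
Proof. by rewrite /p normrZ mulrA. Qed.

(* [G] is the graph of a linear functional dominated by [p] on a subspace; that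
   it is single-valued follows from the domination. *)
Let dominated (G : set (V * R)) : Prop :=
  [/\ G (b, 1),
      forall t x r y s, G (x, r) -> G (y, s) -> G (t *: x + y, t * r + s) &
      forall x r, G (x, r) -> r <= p x].

Let dominated0 G : dominated G -> G (0, 0).
Proof.
by case=> G1 GL _; have := GL (-1) _ _ _ _ G1 G1; rewrite scaleN1r mulN1r !addNr.
Qed.

Let dominatedZ G t x r : dominated G -> G (x, r) -> G (t *: x, t * r).
Proof.
move=> dG Gx; have [_ GL _] := dG.
by have := GL t _ _ _ _ Gx (dominated0 dG); rewrite !addr0.
Qed.

(** The value [a] at [z] has to lie between all [r - p (x - z)] and all [p (x' + z) - r'];
    subadditivity orders these bounds, and [a] is the supremum of the lower ones. If [z] is already
    in the domain, the two bounds force the old value, so no case distinction arises. *)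
Let dominated_extend G z : dominated G ->
  exists a, dominated [set u | exists x r t, G (x, r) /\
                                u = (x + t *: z, r + t * a)].
Proof.
move=> dG; have [G1 GL Gp] := dG.
pose S := [set q.2 - p (q.1 - z) | q in G].
have Sub x' r' : G (x', r') -> ubound S (p (x' + z) - r').
  move=> Gx' _ [[x r] Gx <-]/=.
  have := GL 1 _ _ _ _ Gx Gx'; rewrite scale1r mul1r => /Gp.
  have := pD (x - z) (x' + z).
  have -> : x - z + (x' + z) = x + x' by rewrite addrACA addNr addr0.
  by lra.
have S0 : S !=set0 by exists (1 - p (b - z)), (b, 1).
have Su : has_ubound S by exists (p (b + z) - 1); exact: Sub.
pose a := sup S.
have aub x r : G (x, r) -> r + a <= p (x + z).
  by move=> /Sub ub; rewrite addrC -lerBrDr; apply: ge_sup.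
have alb x r : G (x, r) -> r - a <= p (x - z).
  move=> Gx; rewrite lerBlDr -lerBlDl.
  by apply: ub_le_sup => //; exists (x, r).
exists a; split.
- by exists b, 1, 0; rewrite scale0r mul0r !addr0.
- move=> t _ _ _ _ [x [r [c [Gx [-> ->]]]]] [y [s [d [Gy [-> ->]]]]].
  exists (t *: x + y), (t * r + s), (t * c + d); split; first exact: GL.
  congr pair; last by ring.
  by rewrite scalerDr scalerDl scalerA addrACA.
- move=> _ _ [x [r [t [Gx [-> ->]]]]].
  have [t0|t0|->] := ltgtP t 0; last by rewrite scale0r mul0r !addr0 Gp.
  + have := alb _ _ (dominatedZ (- t)^-1 dG Gx).
    rewrite -(ler_pM2l (x := - t)) ?oppr_gt0//.
    have tN0 : - t != 0 by rewrite oppr_eq0 lt_eqF.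
    rewrite mulrBr mulrA divff// mul1r mulNr opprK => /le_trans; apply.
    rewrite -[X in X * p _]gtr0_norm ?oppr_gt0// -pZ scalerBr scalerA divff//.
    by rewrite scale1r scaleNr opprK.
  + have := aub _ _ (dominatedZ t^-1 dG Gx).
    rewrite -(ler_pM2l (x := t))//.
    have tN0 : t != 0 by rewrite gt_eqF.
    rewrite mulrDr mulrA divff// mul1r => /le_trans; apply.
    by rewrite -[X in X * p _]gtr0_norm// -pZ scalerDr scalerA divff// scale1r.
Qed.

Let line_dominated : dominated [set (t *: b, t) | t in [set: R]].
Proof.
split.
- by exists 1; rewrite ?scale1r.
- move=> t _ _ _ _ [c _ [<- <-]] [d _ [<- <-]].
  by exists (t * c + d) => //; rewrite scalerDl scalerA.
- move=> _ _ [t _ [<- <-]].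
  by rewrite pZ /p divff ?mulr1 ?normr_eq0// ler_norm.
Qed.

Lemma norming_functional :
  exists f : {scalar V}, f b = 1 /\ forall x, `|f x| <= `|x| / `|b|.
Proof.
have [F Fch Ftot|G [PG Gmax]] := @Zorn_bigcup _ [set G | G = set0 \/ dominated G].
  have [F0|/existsNP[G0 /not_implyP[FG0 nG0]]] := pselect (forall G, F G -> G = set0).
    by left; apply: bigcup0.
  have dF G : F G -> G !=set0 -> dominated G.
    by move=> /Fch[->|//] [].
  have G0n : G0 !=set0 by apply/set0P/eqP.
  right; split.
  - by exists G0 => //; have [] := dF _ FG0 G0n.
  - move=> t x r y s [A FA Ax] [B FB By].
    have [AB|BA] := Ftot _ _ FA FB.
    + exists B => //; have [_ L _] := dF _ FB (ex_intro _ _ By).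
      by apply: L => //; exact: AB.
    + exists A => //; have [_ L _] := dF _ FA (ex_intro _ _ Ax).
      by apply: L => //; exact: BA.
  - move=> x r [A FA Ax]; have [_ _ D] := dF _ FA (ex_intro _ _ Ax).
    exact: D.
have dG : dominated G.
  case: PG => // G0; exfalso.
  apply: (Gmax [set (t *: b, t) | t in [set: R]]); last by right.
  by rewrite G0; split=> [? []|s]; apply: (s (1 *: b, 1)); exists 1.
have [G1 GL Gp] := dG.
have total z : exists r, G (z, r).
  have [a da] := dominated_extend z dG; exists a.
  apply: contrapT => nG.
  apply: (Gmax _ _ (or_intror da)); split => [[x r] Gx|sG].
    by exists x, r, 0; rewrite scale0r mul0r !addr0.
  apply/nG/sG; exists 0, 0, 1; split; first exact: dominated0.
  by rewrite scale1r mul1r !add0r.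
have Gfun x r s : G (x, r) -> G (x, s) -> r = s.
  have le u v : G (x, u) -> G (x, v) -> v <= u.
    move=> Gu Gv; have := GL (-1) _ _ _ _ Gu Gv.
    rewrite scaleN1r addNr mulN1r => /Gp.
    by rewrite /p normr0 mul0r; lra.
  by move=> Gr Gs; apply/le_anti; rewrite !le.
have [f fG] := choice total.
have flin : linear (f : V -> R^o).
  move=> t x y; apply: (Gfun (t *: x + y)); first exact: fG.
  by apply: GL; exact: fG.
pose L := GRing.isLinear.Build _ _ _ _ (f : V -> R^o) flin.
pose fL : {scalar V} := HB.pack (f : V -> R^o) L.
exists fL; split; first exact: (Gfun b).
move=> x; rewrite ler_norml; apply/andP; split; last exact/Gp/fG.
rewrite lerNl; have := Gp _ _ (fG (- x)).
have -> : f (- x) = - f x by rewrite -[f]/(fL : V -> R) linearN.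
by rewrite /p normrN.
Qed.

End HahnBanach.

(** * Closed subspaces and bounded functionals *)

Section ClosedSubspaces.
Context (R : realType) (E : normedModType R).
Implicit Types (V N : closedSubspace E).

Record dual := Dual {
  dual_val :> {scalar E};
  dual_bounded : exists C, forall x, `|dual_val x| <= C * `|x|
}.
Implicit Types (f g : dual).

Lemma bounded_continuous (F : normedModType R) (h : {linear E -> F}) C :
  (forall x, `|h x| <= C * `|x|) -> continuous h.
Proof.
move=> hC; apply/bounded_linear_continuous/bounded_funP => r.
exists (`|C| * r) => x xr; apply: (le_trans (hC x)).
by apply: (@le_trans _ _ (`|C| * `|x|)); [exact/ler_wpM2r/ler_norm | exact: ler_wpM2l].
Qed.

Lemma dual_continuous f : continuous f.
Proof. by have [C /(@bounded_continuous R^o)] := dual_bounded f. Qed.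

Lemma norming_dual (b : E) : b != 0 ->
  exists f, f b = 1 /\ forall x, `|f x| <= `|x| / `|b|.
Proof.
move=> /norming_functional[f [fb fle]].
have fC : exists C, forall x, `|f x| <= C * `|x|.
  by exists `|b|^-1 => x; rewrite mulrC; exact: fle.
by exists (Dual fC).
Qed.

(** Pull back along the projection a functional norming the nonzero class of [b] in the quotient by
    [V]. *)
Lemma separating_dual V (b : E) : b \notin V ->
  exists g, g b = 1 /\ {in V, forall x, g x = 0}.
Proof.
pose Q := quotientType V.
have piV x : x \in V -> \pi_Q x = 0.
  by move=> xV; rewrite -quotient_pi0; apply/quotient_eqP; rewrite subr0.
move=> bV; have pib0 : \pi_Q b != 0.
  apply: contra bV => /eqP; rewrite -quotient_pi0 => /quotient_eqP.
  by rewrite subr0.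
have [f [fb fle]] := norming_functional pib0.
have glin : linear ((fun x => f (\pi_Q x)) : E -> R^o).
  by move=> t x y; rewrite quotient_piD quotient_piZ linearP.
pose L := GRing.isLinear.Build _ _ _ _ ((fun x => f (\pi_Q x)) : E -> R^o) glin.
pose g : {scalar E} := HB.pack ((fun x => f (\pi_Q x)) : E -> R^o) L.
have gC : exists C, forall x, `|g x| <= C * `|x|.
  exists `|\pi_Q b|^-1 => x; apply: (le_trans (fle _)).
  by rewrite mulrC ler_wpM2l ?invr_ge0//; exact: quotient_norm_le.
exists (Dual gC); split => // x /piV xV.
by rewrite /= /g /= xV linear0.
Qed.

Lemma closed_subspace_of (A : set E) :
  A 0 -> (forall t x y, A x -> A y -> A (t *: x + y)) -> closed A ->
  exists V, forall x, x \in V <-> A x.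
Proof.
move=> A0 AL cA.
have sA : submod_closed [pred x | `[< A x >]].
  split=> [|t x y]; first exact/asboolP.
  move=> /asboolP Ax /asboolP Ay; exact/asboolP/AL.
have cA' : closed [set` [pred x | `[< A x >]]].
  suff -> : [set` [pred x | `[< A x >]]] = A by [].
  by apply/seteqP; split=> x /asboolP.
by exists (ClosedSubspace sA cA') => x; split=> /asboolP.
Qed.

Lemma closureNP (A : set E) x :
  closure A x <-> forall e, 0 < e -> exists2 y, A y & `|x - y| < e.
Proof.
split=> [clA e e0|Ae B /nbhs_ballP[e /= e0 eB]].
  have [y [Ay]] := clA _ (nbhsx_ballx x e e0).
  by rewrite -ball_normE /ball_ /= => xy; exists y.
have [y Ay xy] := Ae e e0; exists y; split => //; apply: eB.
by rewrite -ball_normE.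
Qed.

Lemma closedNP (A : set E) :
  (forall x, (forall e, 0 < e -> exists2 y, A y & `|x - y| < e) -> A x) ->
  closed A.
Proof. by move=> h x /closureNP; exact: h. Qed.

Lemma mem_closedNP V x :
  (forall e, 0 < e -> exists2 y, y \in V & `|x - y| < e) -> x \in V.
Proof. by move=> h; apply: (closed_subspaceC (c := V)); exact/closureNP. Qed.

Lemma capker (I : Type) (G : I -> dual) V :
  exists W : closedSubspace E,
    forall x, x \in W <-> x \in V /\ forall i, G i x = 0.
Proof.
apply: (@closed_subspace_of [set x | x \in V /\ forall i, G i x = 0]).
- by split; [exact: rpred0 | move=> i; rewrite linear0].
- move=> t x y [xV xG] [yV yG]; split; first by rewrite rpredD ?rpredZ.
  by move=> i; rewrite linearP xG yG mulr0 addr0.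
- have -> : [set x | x \in V /\ forall i, G i x = 0] =
    [set` V] `&` \bigcap_i (G i @^-1` [set 0]).
    by apply/seteqP; split=> x [xV h]; split=> // i; [move=> _|]; exact: h.
  apply: closedI; first exact: closed_subspaceC.
  apply: closed_bigI => i _; apply: closed_comp; last exact: closed_eq.
  by move=> x _; exact: dual_continuous.
Qed.

(** The issue is closedness. When [b] is outside [V], a functional [g] that separates it reads off
    the coefficient [t = g x], so the sum is the preimage of [V] under the continuous map sending
    [x] to [x - g x *: b]. *)
Lemma line_extension V (b : E) :
  exists W : closedSubspace E,
    forall x, x \in W <-> exists t, x - t *: b \in V.
Proof.
have [bV|bV] := boolP (b \in V).
  exists V => x; split=> [xV|[t h]]; first by exists 0; rewrite scale0r subr0.
  by rewrite -(subrK (t *: b) x) rpredD ?rpredZ.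
have [g [gb gV]] := separating_dual bV.
apply: (@closed_subspace_of [set x | exists t, x - t *: b \in V]).
- by exists 0; rewrite scale0r subr0 rpred0.
- move=> t x y [c xc] [d yd]; exists (t * c + d).
  rewrite scalerDl -scalerA opprD addrACA -scalerBr rpredD// rpredZ//.
- have -> : [set x | exists t, x - t *: b \in V] =
    (fun x => x - (g x : R) *: b) @^-1` [set` V].
    apply/seteqP; split=> x /=; last by exists (g x).
    case=> t xt; have /eqP := gV _ xt.
    by rewrite linearB linearZ /= gb mulr1 subr_eq0 => /eqP ->.
  apply: closed_comp; last exact: closed_subspaceC.
  move=> x _; apply: cvgB; first exact: cvg_id.
  by apply: cvgZl; exact: dual_continuous.
Qed.

End ClosedSubspaces.

(** * Convergence with an explicit rate *)

Lemma natSinv_lt (R : realType) (e : R) : 0 < e ->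
  exists N : nat, forall n, (N <= n)%N -> n.+1%:R^-1 < e.
Proof. by move=> e0; have [N _ h] := near_infty_natSinv_lt (PosNum e0); exists N. Qed.

Lemma cvg_rate (R : realType) (E : completeNormedModType R) (x : nat -> E)
    (r : nat -> R) :
  (forall n m, (n <= m)%N -> `|x m - x n| <= r n) ->
  (forall e, 0 < e -> exists n, r n < e) ->
  exists l, forall n, `|l - x n| <= r n.
Proof.
move=> xr r0.
have /cauchy_cvgP/cvg_ex[l xl] : cauchy (x @ \oo).
  apply/cauchy_exP => e e0; have [n rn] := r0 e e0; exists (x n), n => // m /= nm.
  by rewrite -ball_normE /ball_ /= distrC; apply: le_lt_trans rn; exact: xr.
exists l => n; apply/ler_addgt0Pr => e e0.
have /cvgrPdist_lt/(_ e e0)[N _ lN] := xl.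
rewrite -(subrKA (x (maxn n N))) (le_trans (ler_normD _ _))// addrC lerD//.
  by apply: xr; rewrite leq_maxl.
by apply/ltW/lN; rewrite /= leq_maxr.
Qed.

(** * Sums of closed subspaces *)

Section SumClosed.
Context (R : realType) (E : completeNormedModType R).
Implicit Types (X Y V N : closedSubspace E) (G : seq (dual E)).

(** The lower bound makes the [X]-components of approximants [x n + y n] of [z] a Cauchy sequence;
    with limit [l] in [X], the [y n] then tend to [z - l] in [Y]. *)
Lemma bounded_below_sum_closed X Y (d : R) : 0 < d ->
  (forall u y, u \in X -> y \in Y -> d * `|u| <= `|u - y|) ->
  closed (sum_subspace X Y).
Proof.
move=> d0 dXY; apply: closedNP => z zXY.
have /choice[q qP] n : exists q : E * E,
    [/\ q.1 \in X, q.2 \in Y & `|z - (q.1 + q.2)| < n.+1%:R^-1].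
  by have [|_ [x xX [y yY <-]] zxy] := zXY n.+1%:R^-1; [rewrite invr_gt0 | exists (x, y)].
pose x n := (q n).1; pose y n := (q n).2.
have invn_le (n m : nat) : (n <= m)%N -> m.+1%:R^-1 <= n.+1%:R^-1 :> R.
  by move=> nm; rewrite lef_pV2 ?posrE// ler_nat ltnS.
(* [d * |x m - x n|] is at most the distance between two approximants of [z], which is at most twice
   the larger error. *)
have [n m nm|e e0|l lx] := @cvg_rate R E x (fun n => 2 / d * n.+1%:R^-1).
- have [xn yn zn] := qP n; have [xm ym zm] := qP m.
  have := dXY (x m - x n) (y n - y m) (rpredB xm xn) (rpredB yn ym).
  rewrite -ler_pdivlMl// => /le_trans; apply.
  rewrite [2 / d]mulrC -mulrA ler_pM2l ?invr_gt0// mulr_natl mulr2n.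
  have -> : x m - x n - (y n - y m) = (z - (x n + y n)) - (z - (x m + y m)).
    by rewrite !opprB [RHS]addrC subrKA opprD addrACA.
  rewrite (le_trans (ler_normB _ _))// lerD ?(ltW zn)// ltW// (lt_le_trans zm)//.
  exact: invn_le.
- have [k /(_ k (leqnn k)) ke] := natSinv_lt (mulr_gt0 (divr_gt0 d0 (ltr0Sn R 1)) e0).
  by exists k; rewrite -ltr_pdivlMl ?divr_gt0// invf_div.
have lX : l \in X.
  apply: mem_closedNP => e e0.
  have [k /(_ k (leqnn k)) ke] := natSinv_lt (mulr_gt0 (divr_gt0 d0 (ltr0Sn R 1)) e0).
  exists (x k); first by have [] := qP k.
  by apply: (le_lt_trans (lx k)); rewrite -ltr_pdivlMl ?divr_gt0// invf_div.
exists l => //; exists (z - l); last by rewrite addrC subrK.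
apply: mem_closedNP => e e0.
have c0 : 0 < 2 / d + 1 by rewrite ltr_wpDl// divr_ge0// ltW.
have [k /(_ k (leqnn k)) ke] := natSinv_lt (divr_gt0 e0 c0).
have [xk yk zk] := qP k; exists (y k) => //.
have -> : z - l - y k = (z - (x k + y k)) - (l - x k).
  by rewrite opprB opprD !addrA [z - _ - _ + _]addrAC subrK addrAC.
rewrite (le_lt_trans (ler_normB _ _))//.
rewrite (lt_le_trans (ltr_leD zk (lx k)))// -[X in X + _]mul1r -mulrDl addrC.
by rewrite -ler_pdivlMl// ltW// mulrC.
Qed.

(** Induction on [G]. Cutting [X] down to the kernel [W] of [g] loses at most one direction [b], and
    adding a line to the closed subspace [W + Y] keeps it closed. *)
Lemma bounded_below_capker_sum_closed X Y G (d : R) : 0 < d ->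
  (forall u y, u \in X -> all (fun g : dual E => g u == 0) G -> y \in Y ->
     d * `|u| <= `|u - y|) ->
  closed (sum_subspace X Y).
Proof.
move=> d0; elim: G X => [|g G IH] X dXY.
  by apply: (bounded_below_sum_closed d0) => u y uX yY; exact: dXY.
have [[b [bX gb]]|/forallNP gX] := pselect (exists b, b \in X /\ g b != 0); last first.
  apply: IH => u y uX uG yY; apply: dXY => //=; rewrite uG andbT.
  by have /not_andP[//|/negP] := gX u; rewrite negbK.
have [W WP] := capker (fun _ : unit => g) X.
have cW : closed (sum_subspace W Y).
  apply: IH => u y /WP[uX gu] uG yY; apply: dXY => //=.
  by rewrite uG (gu tt) eqxx.
have [S SP] : exists S : closedSubspace E, forall x, x \in S <-> sum_subspace W Y x.
  apply: closed_subspace_of => //.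
    by exists 0; [exact: rpred0 | exists 0; [exact: rpred0 | rewrite addr0]].
  move=> t _ _ [x xW [y yY <-]] [x' xW' [y' yY' <-]].
  exists (t *: x + x'); first by rewrite /= rpredD// rpredZ.
  by exists (t *: y + y'); [rewrite /= rpredD// rpredZ | rewrite scalerDr addrACA].
have [T TP] := line_extension S b.
suff -> : sum_subspace X Y = [set` T] by exact: closed_subspaceC.
apply/seteqP; split=> [_ [x xX [y yY <-]]|z /TP[t /SP[x /WP[xX _] [y yY xy]]]].
  apply/TP; exists (g x / g b); apply/SP.
  exists (x - (g x / g b) *: b); last by exists y => //; rewrite addrAC.
  apply/WP; split=> [|_]; first by rewrite rpredB// rpredZ.
  by rewrite linearB linearZ/= divfK// subrr.
exists (x + t *: b); first by rewrite /= rpredD// rpredZ.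
by exists y => //; rewrite addrAC xy subrK.
Qed.

Lemma near_unit_vector X Y : ~ closed (sum_subspace X Y) ->
  forall G (d : R), 0 < d ->
  exists u y, [/\ u \in X, all (fun g : dual E => g u == 0) G, y \in Y,
    `|u| = 1 & `|u - y| < d].
Proof.
move=> ncl G d d0; apply: contrapT => nu; apply: ncl.
apply: (@bounded_below_capker_sum_closed X Y G d d0) => u y uX uG yY.
have [->|u0] := eqVneq u 0; first by rewrite normr0 mulr0.
rewrite leNgt; apply/negP => uy; apply: nu.
have un : 0 < `|u| by rewrite normr_gt0.
exists (`|u|^-1 *: u), (`|u|^-1 *: y); split; rewrite ?rpredZ//.
- apply: sub_all uG => g /eqP gu; apply/eqP.
  by rewrite linearZ gu; exact: mulr0.
- by rewrite normrZ normfV normr_id mulVf// gt_eqF.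
- by rewrite -scalerBr normrZ normfV normr_id ltr_pdivrMl// mulrC.
Qed.

End SumClosed.

(** * Finite-dimensional extensions of a closed subspace *)

Section Spans.
Context (R : realType) (E : normedModType R).
Implicit Types (X N : closedSubspace E) (G : seq (dual E)).

(** This is [N + span bs], built one line at a time so that inductions on [bs] can use
    [line_extension]. *)
Fixpoint in_span N (bs : seq E) (x : E) : Prop :=
  if bs is b :: bs' then exists t, in_span N bs' (x - t *: b) else x \in N.

Lemma span_extension N (bs : seq E) :
  exists W : closedSubspace E, forall x, x \in W <-> in_span N bs x.
Proof.
elim: bs => [|b bs [W WP]]; first by exists N.
have [T TP] := line_extension W b; exists T => x; rewrite TP.
by split=> -[t /WP]; exists t.
Qed.

Lemma in_span_base N bs x : x \in N -> in_span N bs x.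
Proof.
by elim: bs => //= b bs IH /IH h; exists 0; rewrite scale0r subr0.
Qed.

Lemma in_span_mem N bs x : x \in bs -> in_span N bs x.
Proof.
elim: bs => //= b bs IH; rewrite in_cons => /orP[/eqP ->|/IH h].
  by exists 1; rewrite scale1r subrr; apply: in_span_base; exact: rpred0.
by exists 0; rewrite scale0r subr0.
Qed.

(** Each functional in [G] costs at most one further spanning vector, so a common kernel of finitely
    many functionals is as large as [X] modulo finite dimension. *)
Lemma in_span_capker X N G bs :
  (forall x, x \in X -> all (fun g : dual E => g x == 0) G -> in_span N bs x) ->
  exists bs', forall x, x \in X -> in_span N bs' x.
Proof.
elim: G X => [|g G IH] X h; first by exists bs => x xX; exact: h.
have [[b [bX gb]]|/forallNP gX] := pselect (exists b, b \in X /\ g b != 0); last first.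
  apply: IH => u uX uG; apply: h => //=; rewrite uG andbT.
  by have /not_andP[//|/negP] := gX u; rewrite negbK.
have [W WP] := capker (fun _ : unit => g) X.
have [u /WP[uX gu] uG|bs' bsP] := IH W; first by apply: h => //=; rewrite uG (gu tt) eqxx.
exists (b :: bs') => x xX /=; exists (g x / g b); apply/bsP/WP.
split=> [|_]; first by rewrite rpredB// rpredZ.
by rewrite linearB linearZ/= divfK// subrr.
Qed.

Lemma separating_capker X N G bs :
  (forall bs', exists2 x, x \in X & ~ in_span N bs' x) ->
  exists x (g : dual E), [/\ x \in X, all (fun h : dual E => h x == 0) G,
    g x = 1, {in N, forall z, g z = 0} & all (fun b => g b == 0) bs].
Proof.
move=> infX.
have [x [xX xG nx]] : exists x, [/\ x \in X,
    all (fun h : dual E => h x == 0) G & ~ in_span N bs x].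
  apply: contrapT => nx.
  have [x xX xG|bs' bsP] := @in_span_capker X N G bs.
    by apply: contrapT => nxs; apply: nx; exists x.
  by have [x xX] := infX bs'; apply; exact: bsP.
have [W WP] := span_extension N bs.
have [|g [gx gW]] := @separating_dual _ _ W x; first by apply/negP => /WP.
exists x, g; split=> //.
  by move=> z zN; apply/gW/WP; exact: in_span_base.
by apply/allP => b bbs; apply/eqP/gW/WP; exact: in_span_mem.
Qed.

End Spans.

(** * Nuclear perturbations of the identity *)

(** Dependent choice in which each term may depend on the list of all earlier ones. *)
Lemma history_choice (T : Type) (P : seq T -> T -> Prop) :
  (forall s, exists t, P s t) ->
  exists f : nat -> T, forall n, P (mkseq f n) (f n).
Proof.
move=> /choice[c cP].
pose h := fix h n := if n is m.+1 then rcons (h m) (c (h m)) else [::].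
exists (fun n => c (h n)) => n.
suff -> : mkseq (fun n => c (h n)) n = h n by [].
by elim: n => // n IH; rewrite mkseqS IH.
Qed.

Section Perturbation.
Context (R : realType) (E : completeNormedModType R).
Implicit Types (X Y N : closedSubspace E).

Lemma perturbation_data X Y N (d : nat -> R) : (forall n, 0 < d n) ->
  ~ closed (sum_subspace X Y) ->
  (forall bs, exists2 x, x \in X & ~ in_span N bs x) ->
  exists (u y x : nat -> E) (f g : nat -> dual E),
  [/\ forall n, [/\ u n \in X, y n \in Y, `|u n| = 1 & `|u n - y n| < d n],
      forall n, f n (u n) = 1 /\ forall z, `|f n z| <= `|z|,
      forall k n, (k < n)%N -> f k (u n) = 0,
      [/\ forall n, x n \in X, forall n, g n (x n) = 1 &
          forall k n, (k < n)%N -> g k (x n) = 0] &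
      (forall k n, g k (u n) = 0) /\ forall n, {in N, forall z, g n z = 0}].
Proof.
move=> d0 ncl infX.
pose T := (E * E * E * dual E * dual E)%type.
pose tu (t : T) := t.1.1.1.1; pose ty (t : T) := t.1.1.1.2.
pose tx (t : T) := t.1.1.2; pose tf (t : T) := t.1.2; pose tg (t : T) := t.2.
pose P (s : seq T) (t : T) :=
  [/\ [/\ tu t \in X, ty t \in Y, `|tu t| = 1 & `|tu t - ty t| < d (size s)],
      tf t (tu t) = 1 /\ (forall z, `|tf t z| <= `|z|),
      all (fun q => (tf q (tu t) == 0) && (tg q (tu t) == 0)) s,
      [/\ tx t \in X, tg t (tx t) = 1 & all (fun q => tg q (tx t) == 0) s] &
      all (fun q => tg t (tu q) == 0) s /\
      tg t (tu t) = 0 /\ {in N, forall z, tg t z = 0}].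
have [s|t tP] := @history_choice T P.
  (* The new [u] is killed by all earlier [f] and all earlier [g]. *)
  have [u [y [uX uG yY u1 uy]]] :=
    near_unit_vector ncl (map tf s ++ map tg s) (d0 (size s)).
  have u0 : u != 0 by rewrite -normr_gt0 u1.
  have [f [fu fle]] := norming_dual u0.
  (* Since [g] is chosen after [u], it can be made to vanish on this [u] and on the earlier ones;
     with the previous choice, every [g k] kills every [u n]. *)
  have [x [g [xX xG gx gN /= /andP[/eqP gu gs]]]] :=
    separating_capker (map tg s) (u :: map tu s) infX.
  exists (u, y, x, f, g); split=> //=.
  - by split=> // z; have := fle z; rewrite u1 divr1.
  - by move: uG; rewrite all_cat !all_map all_predI.
  - by split=> //; move: xG; rewrite all_map.
  - by split=> //; move: gs; rewrite all_map.
have allP' (a : pred T) n k : all a (mkseq t n) -> (k < n)%N -> a (t k).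
  rewrite /mkseq all_map => /allP h kn; apply: (h k).
  by rewrite mem_iota.
exists (tu \o t), (ty \o t), (tx \o t), (tf \o t), (tg \o t); split.
- by move=> n; have [+ _ _ _ _] := tP n; rewrite size_mkseq.
- by move=> n; have [_ + _ _ _] := tP n.
- move=> k n kn; have [_ _ h _ _] := tP n.
  by have /andP[/eqP] := allP' _ _ _ h kn.
- split.
  + by move=> n; have [_ _ _ [] ] := tP n.
  + by move=> n; have [_ _ _ [] ] := tP n.
  + move=> k n kn; have [_ _ _ [_ _ h] _] := tP n.
    exact/eqP/(allP' _ _ _ h kn).
- split=> [k n|n]; last by have [_ _ _ _ [_ []]] := tP n.
  have [nk|kn|->] := ltngtP n k.
  + have [_ _ _ _ [h _]] := tP k; exact/eqP/(allP' _ _ _ h nk).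
  + have [_ _ h _ _] := tP n; by have /andP[_ /eqP] := allP' _ _ _ h kn.
  + by have [_ _ _ _ [_ []]] := tP k.
Qed.

(* The factorial makes [eta k.+1] negligible with respect to [eta k]. *)
Definition eta (k : nat) : R := (4 ^+ k.+1 * k`!%:R)^-1.

Lemma eta_gt0 k : 0 < eta k.
Proof. by rewrite invr_gt0 mulr_gt0 ?exprn_gt0 ?ltr0n ?fact_gt0. Qed.

Lemma etaS k : eta k.+1 = eta k / (4 * k.+1%:R).
Proof.
rewrite /eta factS natrM (exprS _ k.+1) -invfM; congr (_^-1).
by ring.
Qed.

Lemma etaS_le k : 2 * eta k.+1 <= eta k.
Proof.
rewrite etaS mulrCA ger_pMr ?eta_gt0// ler_pdivrMr ?mulr_gt0 ?ltr0n//.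
by rewrite mul1r -natrM ler_nat; lia.
Qed.

(** By [etaS_le] each term is at most [2 * eta k - 2 * eta k.+1], and these differences
    telescope. *)
Lemma sum_eta_le n m : (n <= m)%N -> \sum_(n <= k < m) eta k <= 2 * eta n - 2 * eta m.
Proof.
elim: m => [|m IH]; first by rewrite leqn0 => /eqP ->; rewrite big_geq// subrr.
rewrite leq_eqVlt => /orP[/eqP ->|]; first by rewrite big_geq// subrr.
rewrite ltnS => nm; rewrite big_nat_recr//=.
by have := IH nm; have := etaS_le m; lra.
Qed.

Lemma eta_lt (e : R) : 0 < e -> exists n, eta n < e.
Proof.
move=> e0; have [n /(_ n (leqnn n)) ne] := natSinv_lt e0.
exists n; apply: le_lt_trans ne; rewrite lef_pV2 ?posrE ?mulr_gt0 ?exprn_gt0 ?ltr0n ?fact_gt0//.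
rewrite -natrX -natrM ler_nat (leq_trans (ltnW (ltn_expl n.+1 (isT : 1 < 4)%N)))//.
by rewrite leq_pmulr// fact_gt0.
Qed.

Variables (f : nat -> dual E) (b : nat -> E).
Hypothesis f_le : forall n z, `|f n z| <= `|z|.
Hypothesis b_le : forall n, `|b n| <= 1.

Definition partial_op (n : nat) (z : E) : E := \sum_(0 <= k < n) (eta k * f k z) *: b k.

Lemma partial_op_dist n m z : (n <= m)%N ->
  `|partial_op m z - partial_op n z| <= 2 * eta n * `|z|.
Proof.
move=> nm; rewrite /partial_op (big_cat_nat (leq0n n) nm)/= addrAC subrr add0r.
rewrite (le_trans (ler_norm_sum _ _ _))//.
apply: (@le_trans _ _ (\sum_(n <= k < m) eta k * `|z|)).
  apply: ler_sum => k _; rewrite normrZ normrM (gtr0_norm (eta_gt0 k)).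
  by rewrite -mulrA ler_pM2l ?eta_gt0// -[leRHS]mulr1 ler_pM.
rewrite -mulr_suml ler_wpM2r// (le_trans (sum_eta_le nm))//.
by rewrite gerBl mulr_ge0// ltW// eta_gt0.
Qed.

Lemma partial_op_linear n : linear (partial_op n).
Proof.
move=> t x y; rewrite /partial_op scaler_sumr -big_split/=.
apply: eq_bigr => k _; rewrite linearP/= mulrDr scalerDl scalerA; congr (_ *: _ + _).
by rewrite /= mulrCA.
Qed.

(** [A] is the pointwise limit of the operators [partial_op n]; linearity and the inclusion of the
    range in a closed [V] pass to the limit. *)
Lemma nuclear_operator : exists A : {linear E -> E},
  [/\ forall n z, `|A z - partial_op n z| <= 2 * eta n * `|z|,
      forall z, `|A z| <= 2^-1 * `|z| &
      forall V : closedSubspace E, (forall n, b n \in V) -> forall z, A z \in V].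
Proof.
have eta_small (z : E) e : 0 < e -> exists n, 2 * eta n * `|z| < e.
  move=> e0; have c0 : 0 < 2 * (`|z| + 1) by rewrite mulr_gt0// ltr_wpDl.
  have [n ne] := eta_lt (divr_gt0 e0 c0); exists n.
  move: ne; rewrite ltr_pdivlMr//; apply: le_lt_trans.
  rewrite [2 * eta n]mulrC -mulrA ler_pM2l ?eta_gt0// ler_pM2l//.
  by rewrite lerDl.
have /choice[A AP] z : exists l, forall n, `|l - partial_op n z| <= 2 * eta n * `|z|.
  by apply: cvg_rate => [n m|e]; [exact: partial_op_dist | exact: eta_small].
have Alin : linear A.
  move=> t x y; apply/eqP; rewrite -subr_eq0 -normr_le0.
  apply/ler_addgt0Pr => e e0; rewrite add0r.
  pose c := 2 * (`|t *: x + y| + `|t| * `|x| + `|y| + 1).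
  have c0 : 0 < c by rewrite mulr_gt0// ltr_wpDl// !addr_ge0// mulr_ge0.
  have [n /ltW ne] := eta_lt (divr_gt0 e0 c0).
  have -> : A (t *: x + y) - (t *: A x + A y) =
      (A (t *: x + y) - partial_op n (t *: x + y)) -
      (t *: (A x - partial_op n x) + (A y - partial_op n y)).
    rewrite partial_op_linear scalerBr.
    rewrite [X in _ = _ - X](_ : _ = t *: A x + A y -
      (t *: partial_op n x + partial_op n y)); last by rewrite opprD addrACA.
    by rewrite [in RHS]opprB subrKA.
  move: ne; rewrite ler_pdivlMr//; apply: le_trans.
  rewrite (le_trans (ler_normB _ _))//.
  have h1 := AP (t *: x + y) n.
  have h2 := AP y n.
  have h3 : `|t *: (A x - partial_op n x)| <= `|t| * (2 * eta n * `|x|).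
    by rewrite normrZ ler_wpM2l.
  have := ler_normD (t *: (A x - partial_op n x)) (A y - partial_op n y).
  rewrite /c; have := eta_gt0 n; nra.
pose L := GRing.isLinear.Build _ _ _ _ A Alin.
exists (HB.pack A L : {linear E -> E}); split=> //= [z|V bV z].
  (* The empty partial sum is zero and [2 * eta 0] is one half. *)
  have := AP z 0%N; rewrite /partial_op big_geq// subr0.
  by rewrite /eta expr1 fact0 mulr1; lra.
apply: mem_closedNP => e /(eta_small z)[n ne]; exists (partial_op n z).
  by apply: rpred_sum => k _; exact: rpredZ.
exact: le_lt_trans (AP z n) ne.
Qed.

End Perturbation.

(** Solving [x + A x = z] amounts to finding a fixed point of the contraction [z - A x]. Uniqueness
    of the solution makes the chosen inverse linear. *)
Lemma linear_perturbation_inverse (R : realType) (E : completeNormedModType R)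
    (A : {linear E -> E}) : (forall z, `|A z| <= 2^-1 * `|z|) ->
  exists psi : {linear E -> E},
    [/\ forall z, psi z + A (psi z) = z, forall z, psi (z + A z) = z &
        forall z, `|psi z| <= 2 * `|z|].
Proof.
move=> A2.
have inj x y : x + A x = y + A y -> x = y.
  move=> /eqP; rewrite -subr_eq0 opprD addrACA -linearB => /eqP xy.
  apply/eqP; rewrite -subr_eq0 -normr_le0.
  have := A2 (x - y); have -> : A (x - y) = - (x - y).
    by apply/eqP; rewrite -addr_eq0 addrC xy.
  by rewrite normrN; lra.
have surj z : exists x, x + A x = z.
  pose h (x : E) := z - A x.
  have ctr : is_contraction (totalfun_ setT h).
    exists (2^-1)%:nng; split=> /=; first by rewrite invf_lt1// ltr1n.
    move=> [x y] _ /=; rewrite /totalfun_ /h opprB addrC subrKA -linearB.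
    by rewrite [leRHS](_ : _ = 2^-1 * `|y - x|) ?A2// distrC.
  have [|x _ xh] := banach_fixed_point ctr closedT; first by exists 0.
  by exists x; rewrite {1}xh /totalfun_ /h subrK.
have [psi psiP] := choice surj.
have psilin : linear psi.
  by move=> t x y; apply: inj; rewrite linearP addrACA -scalerDr !psiP.
pose L := GRing.isLinear.Build _ _ _ _ psi psilin.
exists (HB.pack psi L : {linear E -> E}); split=> //=.
  by move=> z; apply: inj.
move=> z; have := ler_normB z (A (psi z)).
have -> : z - A (psi z) = psi z by rewrite -{1}(psiP z) addrK.
by have := A2 (psi z); lra.
Qed.

(** * Separable quotients *)

Section SeparableQuotient.
Context (R : realType) (E : normedModType R).
Implicit Types (X N V : closedSubspace E).

Lemma closure_subspace (A : set E) :
  A 0 -> (forall t x y, A x -> A y -> A (t *: x + y)) ->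
  exists V, forall x, x \in V <-> closure A x.
Proof.
move=> A0 AL; apply: closed_subspace_of => [|t x y|]; [exact: subset_closure| |exact: closed_closure].
move=> /closureNP Ax /closureNP Ay; apply/closureNP => e e0.
have t0 : 0 < `|t| + 1 by rewrite ltr_wpDl.
have e2 : 0 < e / 2 by rewrite divr_gt0.
have [x' Ax' xx'] := Ax (e / 2 / (`|t| + 1)) (divr_gt0 e2 t0).
have [y' Ay' yy'] := Ay (e / 2) e2.
exists (t *: x' + y'); first exact: AL.
rewrite opprD addrACA -scalerBr (le_lt_trans (ler_normD _ _))// normrZ.
move: xx'; rewrite ltr_pdivlMr// => xx'.
by have := normr_ge0 (x - x'); nra.
Qed.

(** An exchange argument. If [X] is not already inside [N + span bs], some [x0] of [X] has a nonzero
    coordinate along [b] and can replace it. Having the vectors in [X] lets them be lifted to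
    [subspaceType X]. *)
Lemma in_span_sub X N bs : (forall x, x \in X -> in_span N bs x) ->
  exists bs', {subset bs' <= X} /\ forall x, x \in X -> in_span N bs' x.
Proof.
elim: bs X => [|b bs IH] X h; first by exists [::].
have [W WP] := span_extension N bs.
have [XW|/existsNP[x0 /not_implyP[x0X x0W]]] :=
  pselect (forall x, x \in X -> x \in W).
  by apply: IH => x /XW/WP.
have [g [gx0 gW]] := separating_dual (introN idP x0W).
have gb x t : x - t *: b \in W -> g x = t * g b.
  by move=> /gW/eqP; rewrite linearB linearZ subr_eq0 => /eqP.
have gb0 : g b != 0.
  apply/eqP => gb0; have [t /WP/gb] := h _ x0X.
  by rewrite gx0 gb0 mulr0 => /eqP; rewrite oner_eq0.
have [X' X'P] := capker (fun _ : unit => g) X.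
have [x /X'P[xX gx]|bs' [bs'X bs'P]] := IH X'.
  have [t /WP xtW] := h _ xX; apply/WP.
  have /esym/eqP := gb _ _ xtW; rewrite (gx tt) mulf_eq0 (negbTE gb0) orbF.
  by move=> /eqP t0; move: xtW; rewrite t0 scale0r subr0.
exists (x0 :: bs'); split=> [x|x xX].
  by rewrite in_cons => /orP[/eqP ->//|/bs'X/X'P[]].
exists (g x); apply/bs'P/X'P; split=> [|_]; first by rewrite rpredB// rpredZ.
by rewrite linearB linearZ/= gx0 mulr1 subrr.
Qed.

Lemma in_span_finite_dimensional X N (M : closedSubspace (subspaceType X))
    (bs : seq (subspaceType X)) :
  (forall p : subspaceType X, \val p \in N -> p \in M) ->
  (forall p : subspaceType X, in_span N (map (\val : subspaceType X -> E) bs) (\val p)) ->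
  finite_dimensional (quotientType M).
Proof.
move=> NM h; pose Q := quotientType M.
suff H p : in_span N (map (\val : subspaceType X -> E) bs) (\val p) ->
    exists c : nat -> R, \pi_Q p = \sum_(i < size bs) c i *: \pi_Q bs`_i.
  exists (size bs), (fun i => \pi_Q bs`_i) => q.
  have [c] := H _ (h (repr q)); rewrite reprK => ->.
  by exists (fun i => c i).
elim: bs p {h} => [|b bs IH] p /=.
  move=> /NM pM; exists (fun=> 0); rewrite big_ord0 -quotient_pi0.
  by apply/quotient_eqP; rewrite subr0.
case=> t; rewrite [X in in_span _ _ X](_ : _ = \val (p - t *: b)); last first.
  by rewrite linearB linearZ.
move=> /IH[c cP]; exists (fun i => if i is j.+1 then c j else t).
rewrite big_ord_recl/= -cP -quotient_piZ -quotient_piD; congr (\pi_Q _).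
by rewrite addrC subrK.
Qed.

Lemma separable_quotient_data X : has_separable_quotient (subspaceType X) ->
  exists N (w : nat -> E),
  [/\ {subset N <= X}, forall n, w n \in X,
      forall x, x \in X -> forall e, 0 < e ->
        exists n v, v \in N /\ `|x - w n - v| < e &
      forall bs, exists2 x, x \in X & ~ in_span N bs x].
Proof.
move=> [M [infM [D [cD dD]]]]; pose Q := quotientType M.
have [N NP] : exists N, forall x, x \in N <-> exists2 p, p \in M & \val p = x.
  apply: (@closed_subspace_of _ _ [set x | exists2 p, p \in M & \val p = x]).
  - by exists 0; rewrite ?rpred0 ?linear0.
  - move=> t _ _ [p pM <-] [q qM <-]; exists (t *: p + q); last by rewrite linearP.
    by rewrite rpredD// rpredZ.
  - apply: closedNP => z zc.
    have zX : z \in X.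
      apply: mem_closedNP => e /zc[_ [p pM <-] zp].
      by exists (\val p) => //; exact: subspace_valP.
    exists (SubspaceType zX) => //; apply: mem_closedNP => e /zc[_ [p pM <-] zp].
    by exists p.
have [h hinj] := countable_injP D cD.
(* [d] enumerates [D] by inverting the injection [h], with value 0 off its range. *)
have /choice[d dP] n : exists d : Q, forall d', D d' -> h d' = n -> d' = d.
  have [[d [Dd hd]]|/forallNP nd] := pselect (exists d, D d /\ h d = n).
    exists d => d' Dd' hd'; apply: hinj; rewrite ?inE//; congruence.
  by exists 0 => d' Dd' hd'; case: (nd d').
exists N, (fun n => \val (repr (d n))); split.
- by move=> _ /NP[p _ <-]; exact: subspace_valP.
- by move=> n; exact: subspace_valP.
- move=> x xX e e0; pose p := SubspaceType xX.
  have [||q [pq Dq]] := dD (ball (\pi_Q p) e).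
  + by exists (\pi_Q p); exact: ballxx.
  + exact: ball_open.
  have dq := dP _ _ Dq erefl; exists (h q).
  move: pq; rewrite -ball_normE /ball_ /= {1}dq -subr_gt0 => pq.
  (* The slack between [e] and the quotient norm is spent on picking a representative [t] of norm
     below [e]. *)
  have [t tp te] := quotient_norm_adherent (\pi_Q p - d (h q)) pq.
  exists (\val (p - repr (d (h q)) - t)); split.
    apply/NP; eexists; last by reflexivity.
    apply/quotient_eqP; rewrite tp; apply: (addIr (d (h q))).
    by rewrite -{2}[d (h q)]reprK -quotient_piD !subrK.
  rewrite [X in `|X|](_ : _ = \val t).
    by apply: (lt_le_trans te); rewrite addrC subrK.
  have valB (a b : subspaceType X) : \val (a - b) = \val a - \val b by exact: linearB.
  by rewrite !valB opprB addrC subrK.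
- move=> bs; apply: contrapT => nx; apply: infM.
  have [x xX|bs' [bs'X bs'P]] := @in_span_sub X N bs.
    by apply: contrapT => nxs; apply: nx; exists x.
  have [bs'' bs''E] : exists bs'' : seq (subspaceType X),
      bs' = map (\val : subspaceType X -> E) bs''.
    elim: bs' bs'X {bs'P} => [|b bs' IH] bX; first by exists [::].
    have [x xbs'|bs'' ->] := IH; first by apply: bX; rewrite in_cons xbs' orbT.
    have bX' : b \in X by apply: bX; rewrite mem_head.
    by exists (SubspaceType bX' :: bs'').
  apply: (@in_span_finite_dimensional X N M bs'') => [p /NP[q qM /val_inj <-]//|p].
  by rewrite -bs''E; apply/bs'P/subspace_valP.
Qed.

End SeparableQuotient.

(** * Infinite codimension and the construction of [X1] *)

Lemma logn2_frequent (m K : nat) : exists2 k, (K <= k)%N & logn 2 k = m.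
Proof.
(* An odd cofactor above [K] leaves the 2-adic valuation equal to [m]. *)
exists (2 ^ m * K.*2.+1)%N.
  by rewrite (@leq_trans K.*2.+1) ?leq_pmull ?expn_gt0//; lia.
rewrite lognM ?expn_gt0// pfactorK// [X in (_ + X)%N](_ : _ = 0%N) ?addn0//.
by apply: logn_coprime; rewrite coprime2n /= odd_double.
Qed.

(** If [n] classes spanned the quotient, the square matrix of the [h j (x k)] of size [n.+1] would
    factor through dimension [n], although it is triangular with unit diagonal. *)
Lemma triangular_infinite_codim (R : realType) (E : normedModType R)
    (X V : closedSubspace E) (x : nat -> E) (h : nat -> {scalar E}) :
  (forall k, x k \in X) -> (forall j, {in V, forall z, h j z = 0}) ->
  (forall k, h k (x k) = 1) -> (forall j k, (j < k)%N -> h j (x k) = 0) ->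
  infinite_dimensional (quotientType (trace X V)).
Proof.
move=> xX hV0 hx1 hx0 [n [v vP]]; pose Q := quotientType (trace X V).
pose p i : E := \val (repr (v i)).
have /choice[c cP] k : exists c : 'I_n -> R, forall j,
    h j (x k) = \sum_(i < n) h j (p i) * c i.
  have [c cP] := vP (\pi_Q (SubspaceType (xX k))); exists c => j.
  have : SubspaceType (xX k) - \sum_(i < n) c i *: repr (v i) \in trace X V.
    apply/quotient_eqP; rewrite cP.
    rewrite (big_morph _ (@quotient_piD _ _ _) (@quotient_pi0 _ _ _)).
    by apply: eq_bigr => i _; rewrite quotient_piZ reprK.
  rewrite inE linearB linear_sum/= => /(hV0 j)/eqP.
  rewrite linearB subr_eq0 => /eqP ->.
  rewrite linear_sum; apply: eq_bigr => i _.
  by rewrite !linearZ/= mulrC.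
pose M := \matrix_(j < n.+1, k < n.+1) h j (x k).
have ME : M = (\matrix_(j < n.+1, i < n) h j (p i)) *m
              (\matrix_(i < n, k < n.+1) c k i).
  by apply/matrixP => j k; rewrite !mxE cP; apply: eq_bigr => i _; rewrite !mxE.
have detM : \det M = 1.
  rewrite det_trig; first by rewrite big1// => i _; rewrite mxE hx1.
  by apply/is_trig_mxP => j k jk; rewrite mxE hx0.
have /mxrank_unit rM : M \in unitmx by rewrite unitmxE detM unitr1.
have : (\rank M <= n)%N.
  by rewrite ME (leq_trans (mxrankM_maxl _ _))// rank_leq_col.
by rewrite rM ltnn.
Qed.

Theorem corollary3p6 (R : realType) (E : completeNormedModType R)
    (X Y : closedSubspace E) :
  infinite_codimensional X ->
  infinite_codimensional Y ->
  dense (sum_subspace X Y) ->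
  has_separable_quotient (subspaceType X) ->
  ~ closed (sum_subspace X Y) ->
  exists X1 : closedSubspace E,
    [set` X1] `<=` [set` X] /\
    infinite_dimensional (quotientType (trace X X1)) /\
    dense (sum_subspace X1 Y).
Proof.
move=> _ _ XY_dense /separable_quotient_data[N [w [NX wX w_dense infX]]] ncl.
have d_gt0 n : 0 < eta R n / n.+1%:R by rewrite divr_gt0 ?eta_gt0.
have [u [y [x [f [g [uyP fP fu0 [xX gx1 gx0] [gu0 gN0]]]]]]] :=
  perturbation_data d_gt0 ncl infX.
have [N' N'P] := capker g X.
pose b n : E := (1 + `|w (logn 2 n)|)^-1 *: w (logn 2 n).
have b_le n : `|b n| <= 1.
  rewrite normrZ gtr0_norm ?invr_gt0 ?ltr_pwDl// mulrC.
  by rewrite ler_pdivrMr ?mul1r ?lerDr ?ltr_pwDl.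
have [A [AP A2 A_in]] := nuclear_operator (fun n => (fP n).2) b_le.
have [psi [psiK Kpsi psi2]] := linear_perturbation_inverse A2.
have AX z : A z \in X by apply: A_in => n; exact: rpredZ.
(* Writing the image of [N'] under [I + A] as a preimage under the continuous inverse [psi] makes
   its closedness immediate. *)
have [X1 X1P] : exists X1 : closedSubspace E, forall z, z \in X1 <-> psi z \in N'.
  apply: (@closed_subspace_of _ _ [set z | psi z \in N']).
  - by rewrite /= linear0 rpred0.
  - by move=> t z z' /= zN zN'; rewrite linearP rpredD// rpredZ.
  - apply: (@closed_comp _ _ psi [set` N']); last exact: closed_subspaceC.
    by move=> z _; exact: (bounded_continuous psi2).
have N'X1 z : z \in N' -> z + A z \in X1 by move=> zN; apply/X1P; rewrite Kpsi.
exists X1; split; [|split].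
- move=> z /X1P/N'P[zX _].
  by rewrite /= -[z]psiK rpredD.
(* The triangular system of [x] and [g] is transported by [I + A]. *)
- apply: (@triangular_infinite_codim _ _ _ _ (fun k => x k + A (x k))
    (fun j => g j \o psi : {scalar E})) => [k|j z /X1P/N'P[_]|k|j k jk] //=.
  + by rewrite rpredD.
  + by rewrite Kpsi gx1.
  + by rewrite Kpsi gx0.
(* [V] is the closure of [X1 + Y]; the remaining task is to show that it contains [X]. *)
have [|t ? ?|V VP] := @closure_subspace _ _ (sum_subspace X1 Y).
- by exists 0; [exact: rpred0 | exists 0; [exact: rpred0 | rewrite addr0]].
- move=> [z zX [z' zY <-]] [q qX [q' qY <-]].
  exists (t *: z + q); first by rewrite /= rpredD// rpredZ.
  by exists (t *: z' + q'); [rewrite /= rpredD// rpredZ | rewrite scalerDr addrACA].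
have X1V z : z \in X1 -> z \in V.
  move=> zX; apply/VP/subset_closure; exists z => //.
  by exists 0; [exact: rpred0 | rewrite addr0].
have YV z : z \in Y -> z \in V.
  move=> zY; apply/VP/subset_closure; exists 0; first exact: rpred0.
  by exists z => //; rewrite add0r.
have uN' k : u k \in N'.
  by apply/N'P; split=> [|i]; [have [] := uyP k | exact: gu0].
have bV k : exists2 z, z \in V & `|b k - z| <= 2 / k.+1%:R.
  have [ukX ykY uk1 uyk] := uyP k.
  have eta0 := eta_gt0 R k.
  exists ((eta R k)^-1 *: (u k + A (u k) - y k)).
    by apply/rpredZ/rpredB; [exact/X1V/N'X1 | exact: YV].
  (* Only the last term survives, since the earlier [f j] vanish on [u k]. *)
  have Sk : partial_op f b k.+1 (u k) = eta R k *: b k.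
    rewrite /partial_op big_nat_recr//= big_nat_cond big1 => [|j /andP[/= jk _]].
      by rewrite add0r (fP k).1 mulr1.
    by rewrite fu0// mulr0 scale0r.
  have := AP k.+1 (u k); rewrite Sk uk1 mulr1 => AS.
  rewrite -(ler_pM2l eta0) -[X in X * `|_|]gtr0_norm// -normrZ scalerBr.
  rewrite [X in _ - X]scalerA divff ?gt_eqF// scale1r.
  rewrite -normrN opprB.
  have -> : u k + A (u k) - y k - eta R k *: b k =
     (u k - y k) + (A (u k) - eta R k *: b k) by rewrite addrACA addrA addrAC.
  rewrite (le_trans (ler_normD _ _))//.
  (* With [t = eta k / k.+1], the distance from [u k] to [y k] is below [t] and the tail of [A] is
     at most [t / 2], so the sum stays below [2 * t]. *)
  move: AS uyk; rewrite etaS.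
  rewrite [eta R k * (2 / _)]mulrCA (_ : 2 * (_ / (4 * _)) = eta R k / k.+1%:R / 2); last first.
    by field; rewrite nat1r pnatr_eq0.
  by move: (_ / k.+1%:R) (divr_ge0 (ltW eta0) (ler0n R k.+1)) => t; lra.
have wV m : w m \in V.
  apply: mem_closedNP => e e0.
  pose c := 1 + `|w m|.
  have c0 : 0 < c by rewrite ltr_pwDl.
  have [K KP] := natSinv_lt (divr_gt0 (divr_gt0 e0 (ltr0Sn R 1)) c0).
  have [k Kk km] := logn2_frequent m K.
  have [z zV bz] := bV k; exists (c *: z); first exact: rpredZ.
  have -> : w m = c *: b k by rewrite /b km scalerA divff ?gt_eqF// scale1r.
  rewrite -scalerBr normrZ gtr0_norm// mulrC -ltr_pdivlMr//.
  apply: le_lt_trans bz _; rewrite mulrC -ltr_pdivlMr// mulrAC.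
  exact: KP.
have AV z : A z \in V by apply: A_in => n; rewrite rpredZ.
(* Here [z = (z + A z) - A z], where [z + A z] is in [X1] because every [g i] vanishes on [N], and
   the range of [A] is already in [V]. *)
have NV z : z \in N -> z \in V.
  move=> zN; rewrite -[z](addrK (A z)) rpredB//; apply/X1V/N'X1/N'P.
  by split=> [|i]; [exact: NX | exact: gN0].
have XV z : z \in X -> z \in V.
  move=> /w_dense zX; apply: mem_closedNP => e /zX[n [v [vN zv]]].
  by exists (w n + v); [rewrite rpredD//; exact: NV | rewrite opprD addrA].
move=> O O0 oO; have [p [Op [z zX [z' zY zz']]]] := XY_dense O O0 oO.
have /VP clq : z + z' \in V by apply: rpredD; [exact: XV | exact: YV].
have [q [qXY qO]] : sum_subspace X1 Y `&` O !=set0.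
  by apply: clq; apply: open_nbhs_nbhs; split=> //; rewrite zz'.
by exists q.
Qed.
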